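(* Let $\mathcal{A} \subset \omega^\omega$ be an a.d. family and let $\mathcal{E}_0 = \{E \in [\omega \times \omega]^\omega : \text{there are infinitely many } h \in \mathcal{A} \text{ with } |h \cap E| = \omega\}$. If there is a P-coideal $\mathcal{E}$ on $\omega \times \omega$ with $\mathcal{E} \subset \mathcal{E}_0$, then $\mathcal{A}$ is not analytic.
   Context: Functions are identified with their graphs (subsets of $\omega\times\omega$). An a.d. family $\mathcal{A} \subset \omega^\omega$ is one with $|f\cap g|<\omega$ for distinct $f,g\in\mathcal{A}$; analytic refers to the Baire space topology on $\omega^\omega$. For a countable set $A$ and a non-principal ideal $\mathcal{I}$ on $A$, the set $\mathcal{E} = [A]^\omega \setminus \mathcal{I}$ is called a P-coideal on $A$ if whenever $E_0 \supset E_1 \supset \dots$ is a sequence of sets in $\mathcal{E}$, there is $E \in \mathcal{E}$ with $E \subset^* E_n$ (i.e. $E \setminus E_n$ finite) for all $n \in \omega$. *)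

(* Defs.v *)
From HB Require Import structures.
From mathcomp Require Import all_boot all_order.
From mathcomp Require Import all_classical topology.

Set Implicit Arguments.
Unset Strict Implicit.
Unset Printing Implicit Defensive.

Local Open Scope classical_set_scope.

(* The product topology on nat -> nat, each factor carrying the library's
   topology on nat, which is discrete. *)
Definition baire_space : Type := prod_topology (fun _ : nat => nat).

HB.instance Definition _ := Pointed.on baire_space.
HB.instance Definition _ := Topological.on baire_space.

(* The continuous images of the Baire space, together with the empty set; for
   Polish X these are the analytic subsets of X. *)
Definition analytic (X : topologicalType) (A : set X) : Prop :=
  A = set0 \/ exists2 f : baire_space -> X, continuous f & range f = A.

Definition fgraph (f : nat -> nat) : set (nat * nat) := [set p | p.2 = f p.1].

Definition almost_disjoint_family (A : set (nat -> nat)) : Prop :=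
  forall f g, A f -> A g -> f <> g -> finite_set (fgraph f `&` fgraph g).

Definition almost_subset (T : Type) (E F : set T) : Prop :=
  finite_set (E `\` F).

Definition is_ideal (T : Type) (I : set (set T)) : Prop :=
  [/\ I set0, ~ I setT,
      forall X Y, X `<=` Y -> I Y -> I X
    & forall X Y, I X -> I Y -> I (X `|` Y)].

(* Proper ideals that contain all finite sets are non-principal in this sense,
   so the more restrictive common usage of the word is covered as well. *)
Definition nonprincipal (T : Type) (I : set (set T)) : Prop :=
  ~ exists B : set T, I = [set X | X `<=` B].

Definition P_coideal (T : countType) (E : set (set T)) : Prop :=
  (exists I : set (set T),
     [/\ is_ideal I, nonprincipal I & E = [set X | infinite_set X /\ ~ I X]]) /\
  (forall F : nat -> set T,
     (forall n, E (F n)) -> (forall n, F n.+1 `<=` F n) ->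
     exists2 X, E X & forall n, almost_subset X (F n)).

Definition inf_many_meet (A : set (nat -> nat)) : set (set (nat * nat)) :=
  [set E | infinite_set E /\
           infinite_set [set h | A h /\ infinite_set (fgraph h `&` E)]].

(* Main.v *)
(** Let [f] map the Baire space continuously onto [A]. A fusion along the
    P-property yields [X] in the coideal such that every node [s] is either
    orthogonal to [X] (no [f x] with [x] through [s] meets [X] infinitely often)
    or large (below [X], every member of the coideal meets some such [f x]
    infinitely often). If [s] is large, then modulo the ideal all of [X] is
    covered by the graphs of the [f x] for which [x] runs through [s] and
    through large nodes only. Hence two large nodes can always be extended to
    large nodes that force a common new point into both graphs. Starting from
    nodes forcing [f x <> f y] and iterating gives two distinct members of [A]
    with infinite intersection. *)
Require Import Defs.
From mathcomp Require Import all_boot all_order.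
From mathcomp Require Import all_classical topology.

Local Open Scope classical_set_scope.

(* MathComp's [finfun.fgraph] would otherwise take precedence. *)
Local Notation fgraph := Defs.fgraph.

(** * Finite sets, ideals and infinite sets *)

Lemma ideal_finite_set (T : choiceType) (I : set (set T)) :
  is_ideal I -> (forall p, I [set p]) -> forall X, finite_set X -> I X.
Proof.
move=> [I0 _ IS IU] I1 X /finite_seqP[s ->].
elim: s => [|a s IHs]; first by rewrite set_nil.
apply: IS (IU _ _ (I1 a) IHs) => p /=.
by rewrite in_cons => /orP[/eqP ->|ps]; [left|right].
Qed.

Lemma infinite_set_unbounded (T : countType) (X : set T) (n : nat) :
  infinite_set X -> exists2 p, X p & n <= pickle p.
Proof.
move=> Xinf; apply: contrapT => noX; apply: Xinf.
have pickle_inj : {in pickle @^-1` `I_n &, injective (pickle : T -> nat)}.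
  by move=> x y _ _ /(pcan_inj pickleK).
apply: sub_finite_set (finite_preimage pickle_inj (finite_II n)) => p Xp /=.
by rewrite ltnNge; apply/negP => np; apply: noX; exists p.
Qed.

Lemma infinite_set_distinct {T : Type} (X : set T) :
  infinite_set X -> exists x y, [/\ X x, X y & x <> y].
Proof.
move=> Xinf; have [x Xx] := infinite_setN0 Xinf.
have [y [Xy yx]] := infinite_setN0 (infinite_setD Xinf (finite_set1 x)).
by exists x, y; split=> // xy; apply: yx.
Qed.

Lemma infinite_fgraph (h : nat -> nat) : infinite_set (fgraph h).
Proof.
move=> /(finite_image fst); apply: sub_infinite_set infinite_nat => n _.
by exists (n, h n).
Qed.

(** * Deciding countably many properties inside a P-coideal *)

Section Coideal.
Context (T : countType) (I : set (set T)).
Hypotheses (II : is_ideal I) (I1 : forall p, I [set p]).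
Let E : set (set T) := [set X | infinite_set X /\ ~ I X].
Hypothesis EP : forall F : nat -> set T, (forall n, E (F n)) ->
  (forall n, F n.+1 `<=` F n) ->
  exists2 X, E X & forall n, almost_subset X (F n).

Lemma coidealE (X : set T) : ~ I X -> E X.
Proof. by move=> nIX; split=> // /(ideal_finite_set _ _ II I1). Qed.

(** Along a decreasing sequence, [F n.+1] decides [Q n]: either it satisfies [Q n] or none of its
    subsets in [E] does. A pseudo-intersection in [E] inherits all these decisions. *)
Lemma P_coideal_decide (Q : nat -> set T -> Prop) :
  (forall n X Y, almost_subset Y X -> Q n X -> Q n Y) ->
  exists2 X, E X & forall n,
    Q n X \/ forall Y, E Y -> Y `<=` X -> ~ Q n Y.
Proof.
move=> Qsub; case: (II) => _ IT IS IU.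
have ET : E setT by exact: coidealE.
have step (nX : nat * set T) : exists Y, E nX.2 ->
    [/\ E Y, Y `<=` nX.2 & Q nX.1 Y \/
        forall Z, E Z -> Z `<=` Y -> ~ Q nX.1 Z].
  case: nX => n X /=.
  have [[Y [EY YX QY]]|noY] := pselect (exists Y, [/\ E Y, Y `<=` X & Q n Y]).
    by exists Y => _; split=> //; left.
  by exists X => EX; split=> //; right=> Z EZ ZX QZ; apply: noY; exists Z.
have [next nextP] := choice step.
pose F := fix F n := if n is m.+1 then next (m, F m) else setT.
have EF n : E (F n).
  by elim: n => [//|n IHn] /=; case: (nextP (n, F n) IHn).
have FS n : F n.+1 `<=` F n by case: (nextP (n, F n) (EF n)).
have [X EX XF] := EP F EF FS.
exists X => // n.
have [_ _ [QF|noF]] := nextP (n, F n) (EF n).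
  by left; apply: Qsub QF; exact: (XF n.+1).
(* [Y] is almost contained in [F n.+1], so cutting it down to [F n.+1] loses only a finite set,
   which lies in [I]. *)
right=> Y [Yinf nIY] YX QY; apply: (noF (Y `&` F n.+1)).
- apply: coidealE => IYF; apply: nIY.
  apply: IS (IU _ _ IYF (ideal_finite_set _ _ II I1 _ (XF n.+1))).
  move=> p Yp; have [Fp|nFp] := pselect (F n.+1 p); first by left.
  by right; split=> //; exact: YX.
- exact: subIsetr.
- apply: Qsub QY; rewrite /almost_subset.
  suff -> : Y `&` F n.+1 `\` Y = set0 by [].
  by apply/seteqP; split=> // p [[Yp _] nYp].
Qed.

End Coideal.

(** * Initial segments and continuity in the Baire space *)

Definition cylinder (s : seq nat) : set baire_space :=
  [set x | forall i, i < size s -> x i = nth 0 s i].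

Lemma cylinder_mkseq (x : baire_space) (m : nat) : cylinder (mkseq x m) x.
Proof. by move=> i; rewrite size_mkseq => im; rewrite nth_mkseq. Qed.

Lemma cylinder_branch (u : nat -> seq nat) :
  (forall n, size (u n) < size (u n.+1)) ->
  (forall n i, i < size (u n) -> nth 0 (u n.+1) i = nth 0 (u n) i) ->
  exists x, forall n, cylinder (u n) x.
Proof.
move=> usize uext.
have un n : n <= size (u n).
  by elim: n => // n IHn; exact: leq_ltn_trans (usize n).
have umono n k : size (u n) <= size (u (k + n)).
  by elim: k => // k IHk; rewrite addSn (leq_trans IHk)// ltnW.
have uk n k i : i < size (u n) -> nth 0 (u (k + n)) i = nth 0 (u n) i.
  move=> iun; elim: k => // k IHk.
  by rewrite addSn uext// (leq_trans iun).
(* As [u i.+1] has length at least [i.+1], the default [0] is never read. The nodes [u n] and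
   [u i.+1] are compared through their common extension [u (i.+1 + n)]. *)
exists (fun i => nth 0 (u i.+1) i) => n i iun.
by rewrite -(uk i.+1 n i (un i.+1)) -(uk n i.+1 i iun) addnC.
Qed.

(** Counterexamples [y m] agreeing with [x] below [m] would converge to [x], while all [f (y m)]
    avoid the neighbourhood of [f x] given by its value at [k]. *)
Lemma continuous_coordinate (f : baire_space -> baire_space) :
  continuous f -> forall (x : baire_space) (k : nat), exists m,
    forall y : baire_space, (forall i, i < m -> y i = x i) -> f y k = f x k.
Proof.
move=> fcont x k; apply: contrapT => nom.
have /choice[y yP] : forall m, exists y : baire_space,
    (forall i, i < m -> y i = x i) /\ f y k <> f x k.
  move=> m; apply: contrapT => noy; apply: nom; exists m => z zx.
  by apply: contrapT => fz; apply: noy; exists z.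
have yx : y n @[n --> \oo] --> x.
  apply/cvg_sup => i U [V] [[W] oW <-] Wx WU.
  apply: (filterS WU); exists i.+1 => // n /= ni.
  by rewrite /= (yP n).1.
have fxk : nbhs (f x) [set z : baire_space | z k = f x k].
  apply: (@proj_continuous nat (fun=> nat) k (f x) [set f x k]).
  by rewrite nbhs_principalE; exact/principal_filterP.
have /yx [m _ /(_ m (leqnn m))] := fcont x _ fxk; exact: (yP m).2.
Qed.

(** * Large nodes and their common extensions *)

Definition orthogonal (f : baire_space -> baire_space) (X : set (nat * nat))
    (s : seq nat) : Prop :=
  forall x, cylinder s x -> finite_set (fgraph (f x) `&` X).

Section LargeNodes.
Context (f : baire_space -> baire_space) (I : set (set (nat * nat))).
Context (X : set (nat * nat)).
Hypotheses (fcont : continuous f) (II : is_ideal I) (I1 : forall p, I [set p]).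
Hypothesis nIX : ~ I X.

Definition large (s : seq nat) : Prop :=
  forall Y, ~ I Y -> Y `<=` X -> ~ orthogonal f Y s.

Hypothesis orthogonal_or_large : forall s, orthogonal f X s \/ large s.

Lemma infinite_meet_large (x : baire_space) (m : nat) :
  infinite_set (fgraph (f x) `&` X) -> large (mkseq x m).
Proof.
case: (orthogonal_or_large (mkseq x m)) => // /(_ x) orthx.
by case; apply: orthx; exact: cylinder_mkseq.
Qed.

Definition large_cover (s : seq nat) : set (nat * nat) :=
  [set p | exists x, [/\ cylinder s x, forall m, large (mkseq x m)
                       & fgraph (f x) p]].

(** The uncovered part of [X] is orthogonal to [s]: if [f x] met it infinitely often, all initial
    segments of [x] would be large, so the graph of [f x] would be covered. Largeness of [s] then
    puts this part in [I]. *)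
Lemma large_cover_ideal (s : seq nat) : large s -> I (X `\` large_cover s).
Proof.
move=> ls; apply: contrapT => /ls; apply; first exact: subDsetl.
move=> x sx; have [xl|] := pselect (forall m, large (mkseq x m)).
  suff -> : fgraph (f x) `&` (X `\` large_cover s) = set0 by [].
  by apply/seteqP; split=> // p [fp [_]]; apply; exists x.
move=> xnl; apply: contrapT => xinf; apply: xnl => m.
apply: infinite_meet_large; apply: sub_infinite_set xinf.
by apply: setIS; exact: subDsetl.
Qed.

(** Modulo [I], both covers contain [X], which is not in [I]; so their intersection is infinite. *)
Lemma large_covers_meet (s t : seq nat) (n : nat) : large s -> large t ->
  exists p, [/\ large_cover s p, large_cover t p & n <= pickle p].
Proof.
move=> /large_cover_ideal Is /large_cover_ideal It.
have [p [sp tp] np] : exists2 p, (large_cover s `&` large_cover t) p &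
    n <= pickle p.
  apply: infinite_set_unbounded => /(ideal_finite_set _ _ II I1) Ist.
  case: II => _ _ IS IU; apply: nIX.
  apply: IS (IU _ _ Ist (IU _ _ Is It)) => q Xq.
  have [sq|] := pselect (large_cover s q); last by right; left.
  by have [tq|] := pselect (large_cover t q); [left|right; right].
by exists p.
Qed.

Definition extends (s s' : seq nat) : Prop :=
  size s < size s' /\ forall i, i < size s -> nth 0 s' i = nth 0 s i.

Lemma large_cover_extend (s : seq nat) (p : nat * nat) : large_cover s p ->
  exists s', [/\ extends s s', large s' &
    forall y, cylinder s' y -> fgraph (f y) p].
Proof.
move=> [x [sx xl fxp]]; have [m mP] := continuous_coordinate f fcont x p.1.
(* Length [m] fixes the value of [f] at [p.1]; [(size s).+1] makes the extension strict. *)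
exists (mkseq x (maxn m (size s).+1)); split=> //.
  rewrite /extends size_mkseq leq_maxr; split=> // i si.
  by rewrite nth_mkseq ?sx// leq_max ltnS (ltnW si) orbT.
move=> y yx; rewrite /Defs.fgraph /= mP// => i im.
have im' : i < maxn m (size s).+1 by rewrite leq_max im.
by rewrite yx ?size_mkseq// nth_mkseq.
Qed.

Lemma large_common_extension (s t : seq nat) : large s -> large t ->
  exists x y, [/\ cylinder s x, cylinder t y &
    infinite_set (fgraph (f x) `&` fgraph (f y))].
Proof.
move=> ls lt.
pose next_spec (n : nat) (u v : seq nat * seq nat) :=
  [/\ extends u.1 v.1, extends u.2 v.2, large v.1, large v.2 &
   exists2 p, n <= pickle p &
     forall x y, cylinder v.1 x -> cylinder v.2 y ->
       fgraph (f x) p /\ fgraph (f y) p].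
have /choice[next nextP] : forall nu : nat * (seq nat * seq nat), exists v,
    large nu.2.1 -> large nu.2.2 -> next_spec nu.1 nu.2 v.
  move=> [n [u1 u2]] /=.
  have [[l1 l2]|nl] := pselect (large u1 /\ large u2); last first.
    by exists (u1, u2) => l1 l2; case: nl.
  have [p [p1 p2 np]] := large_covers_meet u1 u2 n l1 l2.
  have [v1 [u1v1 lv1 v1p]] := large_cover_extend u1 p p1.
  have [v2 [u2v2 lv2 v2p]] := large_cover_extend u2 p p2.
  exists (v1, v2) => _ _; split=> //; exists p => // x y vx vy.
  by split; [exact: v1p | exact: v2p].
pose u := fix u n := if n is m.+1 then next (m, u m) else (s, t).
have ul n : large (u n).1 /\ large (u n).2.
  by elim: n => [//|n [l1 l2]]; case: (nextP (n, u n) l1 l2).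
have uS n : next_spec n (u n) (u n.+1).
  by have [l1 l2] := ul n; exact: (nextP (n, u n)).
have [x ux] : exists x, forall n, cylinder (u n).1 x.
  by apply: cylinder_branch => n; case: (uS n) => -[].
have [y uy] : exists y, forall n, cylinder (u n).2 y.
  by apply: cylinder_branch => n; case: (uS n) => _ [].
exists x, y; split; [exact: (ux 0) | exact: (uy 0) |].
(* Finitely many common points would have codes below some [N], but stage [N] forces a common point
   of code at least [N]. *)
move=> fin; have [N NP] : exists N, forall p,
    (fgraph (f x) `&` fgraph (f y)) p -> pickle p < N.
  move/finite_seqP: fin => [r ->].
  exists (\max_(p <- r) pickle p).+1 => p /= pr.
  by rewrite ltnS; exact: leq_bigmax_seq.
have [_ _ _ _ [p Np pP]] := uS N.
have /NP := pP x y (ux N.+1) (uy N.+1).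
by rewrite ltnNge Np.
Qed.

End LargeNodes.

(** * The contradiction with almost disjointness *)

Theorem theorem6 (A : set baire_space) :
  almost_disjoint_family A ->
  (exists E : set (set (nat * nat)), P_coideal E /\ E `<=` inf_many_meet A) ->
  ~ analytic A.
Proof.
move=> ad [E [[[I [II _ EI]] EP] EA]] analyticA.
have EI' X : infinite_set X -> ~ I X -> E X by rewrite EI.
have nIT : ~ I setT by case: II.
(* [nonprincipal] does not by itself put finite sets in [I]; but if [p] were
   positive, so would be [fgraph h `|` [set p]], which only [h] meets
   infinitely often. *)
have I1 p : I [set p].
  apply: contrapT => nIp.
  have /EI'/(_ nIT)/EA[_ /infinite_setN0[h [Ah _]]] := infinite_prod_nat.
  have hp_infinite : infinite_set (fgraph h `|` [set p]).
    by apply: sub_infinite_set (infinite_fgraph h); exact: subsetUl.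
  have [] := EA (fgraph h `|` [set p]).
    apply: EI' => // Ihp; apply: nIp; case: II => _ _ IS _.
    by apply: IS Ihp; exact: subsetUr.
  move=> _ /infinite_set_distinct[g [g' [[Ag gh] [Ag' g'h] gg']]].
  have meet_h k : A k -> infinite_set (fgraph k `&` (fgraph h `|` [set p])) ->
      k = h.
    move=> Ak kh; apply: contrapT => /(ad _ _ Ak Ah) finkh; apply: kh.
    rewrite setIUr finite_setU; split=> //.
    by apply: finite_setIr; exact: finite_set1.
  by apply: gg'; rewrite (meet_h _ Ag gh) (meet_h _ Ag' g'h).
case: analyticA => [A0|[f fcont fA]].
  have [_ /infinite_setN0[h [Ah _]]] := EA _ (EI' _ infinite_prod_nat nIT).
  by rewrite A0 in Ah.
rewrite EI in EP EA.
(* Nodes are enumerated by their codes; a number coding no node gets a trivially true property. *)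
pose Q n X := if unpickle n is Some s then orthogonal f X s else True.
have Qsub n X Y : almost_subset Y X -> Q n X -> Q n Y.
  rewrite /Q; case: (unpickle n) => // s YX orthX x /orthX finX.
  suff : finite_set ((fgraph (f x) `&` X) `|` (Y `\` X)).
    apply: sub_finite_set => p [fp Yp].
    by have [Xp|nXp] := pselect (X p); [left|right].
  by rewrite finite_setU.
have [X [Xinf nIX] XP] := P_coideal_decide _ I II I1 EP Q Qsub.
have orth_or_large s : orthogonal f X s \/ large f I X s.
  have := XP (pickle s); rewrite /Q pickleK => -[|noY]; first by left.
  by right=> Y nIY; apply: noY; exact: coidealE.
have [_ /infinite_set_distinct[h [g [[Ah hX] [Ag gX] hg]]]] :=
  EA X (conj Xinf nIX).
move: Ah Ag hX gX hg; rewrite -fA => -[x _ <-] [y _ <-] fxX fyX fxy.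
have [k fxyk] : exists k, f x k <> f y k.
  apply: contrapT => nok; apply: fxy; apply/funext => k.
  by apply: contrapT => fk; apply: nok; exists k.
(* Initial segments of lengths [m] and [n] fix the values at [k], so the images of the new branches
   [x'] and [y'] stay distinct. *)
have [m mP] := continuous_coordinate f fcont x k.
have [n nP] := continuous_coordinate f fcont y k.
have [x' [y' [xx' yy']]] := large_common_extension f I X fcont II I1 nIX
  orth_or_large _ _ (infinite_meet_large f I X orth_or_large x m fxX)
  (infinite_meet_large f I X orth_or_large y n fyX).
have cyl (z z' : baire_space) j : cylinder (mkseq z j) z' ->
    forall i, i < j -> z' i = z i.
  by move=> zz' i ij; rewrite zz' ?size_mkseq// nth_mkseq.
apply; apply: ad; [by rewrite -fA; exists x'|by rewrite -fA; exists y'|].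
move=> /(congr1 (fun h : baire_space => h k)).
by rewrite (mP _ (cyl _ _ _ xx')) (nP _ (cyl _ _ _ yy')).
Qed.
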